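(* Let $p$ be a prime, $r\ge 1$ an integer, $R=\mathbb{Z}/p^r\mathbb{Z}$, $I=pR$ its maximal ideal, $n>1$ an even integer, and $\varepsilon\in\{1,-1\}\subset R$. Let $\omega_n$ be the number of $\overline{\varepsilon}$-quiddity cycles of length $n$ over the field $R/I$, where $\overline{\varepsilon}$ is the image of $\varepsilon$ in $R/I$. Then the number of $\varepsilon$-quiddity cycles of length $n$ over $R$ is $$\begin{cases} (\omega_n-1)\cdot p^{(r-1)(n-3)}+\sigma_n & \text{if } \varepsilon=(-1)^{n/2} \text{ in } R,\\ \omega_n\cdot p^{(r-1)(n-3)} & \text{if } \varepsilon\neq(-1)^{n/2}\text{ in } R \text{ (so } \varepsilon=-(-1)^{n/2}) \text{ and } p>2,\\ (\omega_n-1)\cdot p^{(r-1)(n-3)} & \text{if } \varepsilon\neq(-1)^{n/2}\text{ in } R \text{ (so } \varepsilon=-(-1)^{n/2}) \text{ and } p=2, \end{cases}$$ where $\sigma_2=1$, $\sigma_4=(r-1)p^r-(r-2)p^{r-1}$, and for even $n\ge 6$ $$\sigma_n=p^{(n/2-1)r}\,[r-1]_{p^{n/2-2}}-p^{(n/2-1)r-1}\,[r-2]_{p^{n/2-2}}.$$ (The equalities are understood in the rational numbers.)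
   Context: For a commutative ring $S$ and $a\in S$ put $\eta(a):=\begin{pmatrix} a & -1\\ 1 & 0\end{pmatrix}$. For $\varepsilon\in S$, an $\varepsilon$-quiddity cycle of length $n$ over $S$ is a tuple $(c_1,\ldots,c_n)\in S^n$ with $\eta(c_1)\eta(c_2)\cdots\eta(c_n)=\varepsilon\,\mathrm{id}$, where $\mathrm{id}$ is the $2\times 2$ identity matrix. For an integer $m$ and an integer $q>1$, $[m]_q:=\frac{q^m-1}{q-1}$ (a rational number; in particular $[0]_q=0$ and $[-1]_q=-q^{-1}$). *)

(* Defs.v *)
From HB Require Import structures.
From mathcomp Require Import all_boot all_order all_algebra.

Set Implicit Arguments.
Unset Strict Implicit.
Unset Printing Implicit Defensive.

Import Order.TTheory GRing.Theory Num.Theory.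
Local Open Scope ring_scope.

Definition eta (S : comPzRingType) (a : S) : 'M[S]_2 :=
  \matrix_(i, j) (nth [::] [:: [:: a; -1]; [:: 1; 0]] i)`_j.

Definition quiddity (S : comPzRingType) (eps : S) (n : nat) (c : n.-tuple S)
    : bool :=
  \prod_(i < n) eta (tnth c i) == eps%:M.

Definition num_quiddity (S : finComPzRingType) (eps : S) (n : nat) : nat :=
  #|[set c : n.-tuple S | quiddity eps c]|.

(* The residue field of Z/p^r is taken to be 'F_p, with this projection; the
   lemmas below show that it is a surjective ring morphism with kernel the
   ideal generated by p. *)
Definition residue (p r : nat) (x : 'Z_(p ^ r)) : 'F_p := (x : nat)%:R.

(* Rational-valued, with an integer exponent: negative m is allowed. *)
Definition qint (m : int) (q : nat) : rat := (q%:R ^ m - 1) / (q%:R - 1).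

(* Only used for even n >= 2, where n./2 - 1 and (for n >= 6) n./2 - 2 are not
   truncated. The other subtractions are in int or rat. *)
Definition sigma (p r n : nat) : rat :=
  if n == 2%N then 1
  else if n == 4%N then
    (r%:R - 1) * p%:R ^+ r - (r%:R - 2) * p%:R ^ (r%:Z - 1)
  else
    p%:R ^+ ((n./2 - 1) * r) * qint (r%:Z - 1) (p ^ (n./2 - 2))
    - p%:R ^ (((n./2 - 1) * r)%:Z - 1) * qint (r%:Z - 2) (p ^ (n./2 - 2)).

Section Residue.

Variables p r : nat.
Hypotheses (p_pr : prime p) (r_gt0 : (0 < r)%N).

Let pr_gt1 : (1 < p ^ r)%N.
Proof. by rewrite -(exp1n r) ltn_exp2r // prime_gt1. Qed.

Let natF_mod m : (m %% p ^ r)%:R = m%:R :> 'F_p.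
Proof. by rewrite -Fp_nat_mod // modn_dvdm ?Fp_nat_mod // dvdn_exp. Qed.

Lemma residue_nat m : residue (m%:R : 'Z_(p ^ r)) = m%:R.
Proof. by rewrite /residue val_Zp_nat // natF_mod. Qed.

Lemma residue1 : residue (1 : 'Z_(p ^ r)) = 1.
Proof. exact: (residue_nat 1). Qed.

Lemma residueD : {morph @residue p r : x y / x + y}.
Proof.
by move=> x y; rewrite -[x]natr_Zp -[y]natr_Zp -natrD !residue_nat natrD.
Qed.

Lemma residueM : {morph @residue p r : x y / x * y}.
Proof.
by move=> x y; rewrite -[x]natr_Zp -[y]natr_Zp -natrM !residue_nat natrM.
Qed.

Lemma residue_surj (y : 'F_p) : exists x : 'Z_(p ^ r), residue x = y.
Proof. by exists (y : nat)%:R; rewrite residue_nat natr_Zp. Qed.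

Lemma residue_eq0 (x : 'Z_(p ^ r)) :
  residue x = 0 <-> exists y : 'Z_(p ^ r), x = p%:R * y.
Proof.
split=> [/eqP|[y ->]].
  rewrite /residue -(dvdn_pcharf (pchar_Fp p_pr)) => /dvdnP[k xE].
  by exists k%:R; rewrite -natrM mulnC -xE natr_Zp.
by rewrite residueM residue_nat (pcharf0 (pchar_Fp p_pr)) mul0r.
Qed.

End Residue.

(* Main.v *)
Require Import Defs.
From mathcomp Require Import all_boot all_order all_algebra.
From mathcomp Require Import ring zify.

Set Implicit Arguments.
Unset Strict Implicit.
Unset Printing Implicit Defensive.

Import Order.TTheory GRing.Theory Num.Theory.
Local Open Scope ring_scope.

(**
Write n = 2m. The cycles over Z/p^r are sorted by their reduction mod p, and
the all-zero reduction is treated apart from the others.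

A nonzero reduction lifts in exactly p^((r-1)(n-3)) ways. A cycle can be
rotated, so a nonzero entry b of the reduction may be put in second position.
The equation eta(x) eta(b) eta(y) = eps M^-1, where M is the product over the
remaining n-3 entries and has determinant 1, fixes b, and, when b is a unit,
also x and y; the fourth entry of the equation then follows from the
determinant ([is_cycle_triple]). So the n-3 remaining entries can be lifted
freely, and each choice extends uniquely ([liftsE]).

The cycles reducing to zero are those with entries in I = pR
([num_ideal_cycles]). Follow the bottom row of the partial products: two steps
a, b send (u, v) to (u', -(ua + v)) with u' = (ua + v) b - u. As u stays in I
and v stays a unit, b can be traded for u', which is again arbitrary in I.
In these coordinates v only ever changes by a sign and by the addition of
u a, and, up to the signs of the u_i, the bottom row of the whole product is
the right one if and only if sum u_i a_i = (-1)^m eps - 1, with m-1 free pairs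
(u_i, a_i) in I x I; the very first entry of the cycle is then fixed by the top
row. Hence:

- if eps = (-1)^m, the count is that of the pairs of vectors y, z in I^(m-1)
  with y.z = 0. For y with smallest valuation k, the map z |-> y.z sends
  I^(m-1) onto p^(k+1) R with fibers of equal size ([card_orthogonal]);
  summing over k gives a geometric series, which is sigma
  ([num_dot_geometric], [num_dot_sigma]);
- if eps = -(-1)^m, the sum would have to be -2 while lying in p^2 R. This is
  impossible for p > 2, and also for p = 2, because eps <> (-1)^m forces
  r > 1 ([num_dot_eq0]).

Mod p, the zero tuple is itself a cycle exactly when eps = (-1)^m in the
residue field; this accounts for omega - 1 against omega.
*)

(** * Sums over tuples *)
Section TupleSums.

Variables (T : finType) (A : {pred T}).
Implicit Type F : seq T -> nat.

Lemma sum_tuple_cons n F :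
  (\sum_(t : n.+1.-tuple T) F t = \sum_x \sum_(t : n.-tuple T) F (x :: t))%N.
Proof.
rewrite pair_big /=.
rewrite (reindex (fun q : T * n.-tuple T => [tuple of q.1 :: q.2])) //=.
exists (fun t => (thead t, [tuple of behead t])) => [[x t] _ | t _] /=.
  by rewrite theadE; congr (_, _); apply: val_inj.
by rewrite [RHS]tuple_eta.
Qed.

(** The tail is summed outermost because, for a fixed tail, the first three
entries of a cycle will be determined. *)
Lemma sum_tuple_cons3 n F :
  (\sum_(t : n.+3.-tuple T) F t =
   \sum_(t : n.-tuple T) \sum_(q : T * T * T) F [:: q.1.1, q.1.2, q.2 & t])%N.
Proof.
rewrite [RHS]exchange_big /= sum_tuple_cons.
rewrite -(pair_bigA _ (fun q y => \sum_t F [:: q.1, q.2, y & tval t]))%N /=.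
rewrite -(pair_bigA _ (fun x b => \sum_y \sum_t F [:: x, b, y & tval t]))%N /=.
apply: eq_bigr => x _; rewrite (sum_tuple_cons _ (fun t => F (x :: t))).
by apply: eq_bigr => b _; rewrite (sum_tuple_cons _ (fun t => F [:: x, b & t])).
Qed.

Lemma sum_tuple0 F : (\sum_(t : 0.-tuple T | all [in A] t) F t = F [::])%N.
Proof.
rewrite (big_pred1 [tuple]) // => t.
by rewrite (tuple0 t) /= eqxx.
Qed.

Lemma sum_tupleS n F :
  (\sum_(t : n.+1.-tuple T | all [in A] t) F t =
   \sum_(x in A) \sum_(t : n.-tuple T | all [in A] t) F (x :: t))%N.
Proof.
rewrite big_mkcond.
rewrite (sum_tuple_cons n (fun t => if all [in A] t then F t else 0))%N.
rewrite [RHS]big_mkcond; apply: eq_bigr => x _ /=.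
by case: (x \in A) => /=; [rewrite [RHS]big_mkcond | rewrite big1].
Qed.

Lemma sum_tuple_const n m :
  (\sum_(t : n.-tuple T | all [in A] t) m = #|A| ^ n * m)%N.
Proof.
elim: n => [|n IHn]; first by rewrite (sum_tuple0 (fun=> m)) mul1n.
rewrite (sum_tupleS n (fun=> m)) (eq_bigr (fun=> (#|A| ^ n * m)%N)) //.
by rewrite sum_nat_const mulnA expnS.
Qed.

End TupleSums.

(** * Quiddity cycles through row vectors *)
Section RowAction.

Variable S : comPzRingType.
Implicit Types (a u v eps : S) (w : S * S) (c : seq S).

(** The row vector (u, v) times eta(a). Working with rows keeps matrices out
of the inductions, which all peel off the first entry of the cycle. *)
Definition row_step w a := (w.1 * a + w.2, - w.1).
Definition row_act w c := foldl row_step w c.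

Definition is_cycle eps c :=
  (row_act (1, 0) c == (eps, 0)) && (row_act (0, 1) c == (0, eps)).

Lemma row_act_linear u v u' v' a c :
  row_act (a * u + u', a * v + v') c =
  (a * (row_act (u, v) c).1 + (row_act (u', v') c).1,
   a * (row_act (u, v) c).2 + (row_act (u', v') c).2).
Proof.
elim: c u v u' v' => [|x c IHc] u v u' v' //=.
rewrite -IHc; congr row_act; rewrite /row_step /=; congr (_, _); ring.
Qed.

Lemma row_act_basis u v c :
  row_act (u, v) c =
  (u * (row_act (1, 0) c).1 + v * (row_act (0, 1) c).1,
   u * (row_act (1, 0) c).2 + v * (row_act (0, 1) c).2).
Proof.
have run0 : row_act (0, 0) c = (0, 0).
  by elim: c => //= a t; rewrite /row_step /= mul0r addr0 oppr0.
have -> : row_act (u, v) c =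
    row_act (u * 1 + (v * 0 + 0), u * 0 + (v * 1 + 0)) c.
  by congr row_act; congr (_, _); ring.
by rewrite !row_act_linear run0 !addr0.
Qed.

(** The matrices eta(a) have determinant 1. *)
Lemma row_act_det w w' c :
  (row_act w c).1 * (row_act w' c).2 - (row_act w c).2 * (row_act w' c).1 =
  w.1 * w'.2 - w.2 * w'.1.
Proof.
elim: c w w' => [|x c IHc] [u v] [u' v'] //=.
rewrite IHc /row_step /=; ring.
Qed.

Lemma row_act_prod (M : 'M[S]_2) (i : 'I_2) c :
  row_act (M i 0, M i 1) c =
  ((M * \prod_(x <- c) eta x) i 0, (M * \prod_(x <- c) eta x) i 1).
Proof.
elim: c M => [|x c IHc] M; first by rewrite big_nil mulr1.
rewrite big_cons mulrA -IHc /=; congr row_act; rewrite /row_step /=.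
have e1 : lift ord0 ord0 = 1 :> 'I_2 by apply: val_inj.
by congr (_, _); rewrite mxE !big_ord_recl big_ord0 !mxE /= ?e1; ring.
Qed.

Lemma is_cycleE eps c : is_cycle eps c = (\prod_(x <- c) eta x == eps%:M).
Proof.
have E i := row_act_prod 1 i c; rewrite /is_cycle.
have := E 0; rewrite mul1r !mxE /= => ->.
have := E 1; rewrite mul1r !mxE /= => ->.
apply/andP/eqP => [[/eqP[e1 e2] /eqP[e3 e4]] | ->].
  apply/matrixP => i j; rewrite !mxE.
  by case: i j => [[|[|//]] ?] [[|[|//]] ?] /=;
    [rewrite mulr1n -e1 | rewrite mulr0n -e2 | rewrite mulr0n -e3
    | rewrite mulr1n -e4]; congr (fun_of_matrix _ _ _);
    apply: val_inj.
by rewrite !mxE /= !eqxx.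
Qed.

Lemma quiddityE eps n (c : n.-tuple S) : quiddity eps c = is_cycle eps c.
Proof. by rewrite is_cycleE /quiddity big_tuple. Qed.

(** If A B is the scalar eps, then eps A is a left inverse of B, hence also a
right inverse: cycles can be rotated. *)
Lemma is_cycle_cat eps c c' : eps * eps = 1 ->
  is_cycle eps (c ++ c') = is_cycle eps (c' ++ c).
Proof.
move=> eps2; rewrite !is_cycleE !big_cat /=.
set A := \prod_(x <- c) _; set B := \prod_(x <- c') _.
have half (X Y : 'M[S]_2) : X *m Y = eps%:M -> Y *m X = eps%:M.
  move=> XY.
  have /mulmx1C : (eps *: X) *m Y = 1%:M.
    by rewrite -scalemxAl XY scale_scalar_mx eps2.
  rewrite -scalemxAr => /(congr1 (fun Z => eps *: Z)).
  by rewrite scalerA eps2 scale1r scale_scalar_mx mulr1.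
by apply/eqP/eqP; apply: half.
Qed.

End RowAction.

(** * Three consecutive entries are determined by the others *)
Section Triple.

Variable S : comUnitRingType.
Implicit Types (eps : S) (t : seq S).

(** With A B / C D the product over t, the solution of
eta(x) eta(b) eta(y) = eps (D -B / -C A) read off from three of the entries:
the left-hand side has entries (xb - 1) y - x, 1 - xb, by - 1 and -b. *)
Definition first_three eps t : S * S * S :=
  let A := (row_act (1, 0) t).1 in let B := (row_act (1, 0) t).2 in
  let C := (row_act (0, 1) t).1 in let b := - (eps * A) in
  (b^-1 * (1 + eps * B), b, b^-1 * (1 - eps * C)).

Lemma is_cycle_triple_mid eps x b y t :
  is_cycle eps [:: x, b, y & t] -> b = - (eps * (row_act (1, 0) t).1).
Proof.
rewrite /is_cycle /= /row_step /= !mul1r !mul0r !addr0 add0r !subr0 !mul1r.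
rewrite (row_act_basis _ _ t) [row_act (b * y - _, _) t]row_act_basis.
have := row_act_det (1, 0) (0, 1) t.
case: (row_act (1, 0) t) => A B; case: (row_act (0, 1) t) => C D /=.
rewrite mulr1 mulr0 subr0 => detT /andP[_ /eqP[e3 e4]].
transitivity (b * (A * D - B * C)); first by rewrite detT mulr1.
rewrite -e4 -[RHS]addr0 -(mulr0 B) -e3; ring.
Qed.

(** The three equations solved by [first_three] imply the fourth one after
multiplication by b, since both sides have determinant 1; so it matters that A,
and hence b = - eps A, is a unit. *)
Lemma is_cycle_triple eps x b y t :
  eps * eps = 1 -> (row_act (1, 0) t).1 \is a GRing.unit ->
  is_cycle eps [:: x, b, y & t] = ((x, b, y) == first_three eps t).
Proof.
move=> eps2 UA.
have Ueps : eps \is a GRing.unit by apply/unitrPr; exists eps.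
apply/idP/eqP => [q | [] ].
  have bE := is_cycle_triple_mid q.
  have Ub : b \is a GRing.unit by rewrite bE unitrN unitrMl.
  move: q bE; rewrite /first_three /is_cycle /= /row_step /=.
  rewrite !mul1r !mul0r !addr0 add0r !subr0 !mul1r.
  rewrite (row_act_basis _ _ t) [row_act (b * y - _, _) t]row_act_basis.
  have := row_act_det (1, 0) (0, 1) t.
  move: UA; case: (row_act (1, 0) t) => A B.
  case: (row_act (0, 1) t) => C D /= UA.
  rewrite mulr1 mulr0 subr0 => detT /andP[/eqP[e1 e2] /eqP[e3 e4]] bE.
  rewrite -bE; congr (_, _, _); apply: (mulrI Ub); rewrite mulrA mulrV // mul1r.
    transitivity (1 - (1 - x * b) * (A * D - B * C)).
      by rewrite detT; ring.
    rewrite -e1 -[LHS]addr0 -(mulr0 A) -e2; ring.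
  transitivity (1 + (b * y - 1) * (A * D - B * C)).
    by rewrite detT; ring.
  rewrite -e4 -[RHS]addr0 -(mulr0 D) -e3; ring.
rewrite /first_three => xE bE yE; rewrite /is_cycle /= /row_step /=.
rewrite !mul1r !mul0r !addr0 add0r !subr0 !mul1r.
rewrite (row_act_basis _ _ t) [row_act (b * y - _, _) t]row_act_basis.
have := row_act_det (1, 0) (0, 1) t.
move: UA xE bE yE; case: (row_act (1, 0) t) => A B.
case: (row_act (0, 1) t) => C D /= UA xE bE yE.
rewrite mulr1 mulr0 subr0 => detT.
have Ub : b \is a GRing.unit by rewrite bE unitrN unitrMl.
have xb : b * x = 1 + eps * B by rewrite xE -bE mulrA mulrV // mul1r.
have yb : b * y = 1 - eps * C by rewrite yE -bE mulrA mulrV // mul1r.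
have X : (x * b - 1) * y - x = eps * D.
  apply: (mulrI Ub).
  transitivity (b * x * (b * y) - b * y - b * x); first by ring.
  rewrite xb yb bE.
  transitivity (- (eps * eps) * (B * C) - 1); first by ring.
  transitivity (- (eps * eps) * (A * D)); last by ring.
  have -> : A * D = 1 + B * C by rewrite -detT; ring.
  by rewrite eps2; ring.
have xb1 : x * b - 1 = eps * B by rewrite mulrC xb; ring.
have yb1 : b * y - 1 = - (eps * C) by rewrite yb; ring.
have epsE : eps = eps * (A * D - B * C) by rewrite detT mulr1.
rewrite X xb1 yb1 bE; apply/andP; split; apply/eqP; congr (_, _);
  do 1?[by ring]; by rewrite [RHS]epsE; ring.
Qed.

End Triple.

(** * Cycles with entries in a small ideal *)
Definition dot (S : pzRingType) (y z : seq S) : S :=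
  \sum_(q <- zip y z) q.1 * q.2.

Section IdealCycles.

Variables (S : finComUnitRingType) (I : {pred S}).
Hypotheses (I0 : 0 \in I) (ID : {in I &, forall x y, x + y \in I}).
Hypothesis IM : forall a x, x \in I -> a * x \in I.
Hypothesis IU : forall u x, u \is a GRing.unit -> x \in I ->
  u + x \is a GRing.unit.

Let IN x : x \in I -> - x \in I.
Proof. by move=> Ix; rewrite -mulN1r IM. Qed.

Definition num_dot l w : nat :=
  (\sum_(y : l.-tuple S | all [in I] y)
    \sum_(z : l.-tuple S | all [in I] z) (dot y z == w))%N.

Lemma num_dot0 w : num_dot 0 w = (w == 0).
Proof.
rewrite /num_dot.
rewrite (sum_tuple0 _
  (fun y => \sum_(z : 0.-tuple S | all [in I] z) (dot y z == w))%N).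
rewrite (sum_tuple0 _ (fun z => (dot [::] z == w) : nat)).
by rewrite /dot big_nil eq_sym.
Qed.

Lemma num_dotS l w :
  num_dot l.+1 w = (\sum_(u in I) \sum_(a in I) num_dot l (w - u * a)%R)%N.
Proof.
rewrite /num_dot.
rewrite (sum_tupleS _ _
  (fun y => \sum_(z : l.+1.-tuple S | all [in I] z) (dot y z == w))%N).
apply: eq_bigr => u _; rewrite [RHS]exchange_big /=; apply: eq_bigr => y _.
rewrite (sum_tupleS _ _ (fun z => (dot (u :: y) z == w) : nat)).
apply: eq_bigr => a _; apply: eq_bigr => z _.
by rewrite /dot /= big_cons /= addrC [in RHS]eq_sym subr_eq eq_sym.
Qed.

(** Change the sign of the second vector. *)
Lemma num_dotN l w : num_dot l (- w) = num_dot l w.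
Proof.
elim: l w => [|l IHl] w; first by rewrite !num_dot0 oppr_eq0.
rewrite !num_dotS; apply: eq_bigr => u _.
rewrite (reindex_inj oppr_inj) /=; apply: eq_big => [a | a _].
  by apply/idP/idP => /IN; rewrite ?opprK.
by rewrite -IHl; congr num_dot; ring.
Qed.

(** The first coordinate u of the starting row is summed over as well, so that
the count is again of this form after two steps; see [num_row_transportsE]. *)
Definition num_row_transports l d v : nat :=
  (\sum_(u in I) \sum_(t : (l.*2).-tuple S | all [in I] t)
    (row_act (u, v) t == (0%R, d)))%N.

(** Two steps lead from (u, v) to (u', -(ua + v)), where u' = (ua + v) b - u.
Since ua + v is a unit, b |-> u' permutes the ideal, so that summing over u
and b amounts to summing over u and u'. Each round thus contributes a free
pair (u, a) which adds u a to v, up to the sign changes. *)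
Lemma num_row_transportsE l d v : v \is a GRing.unit ->
  num_row_transports l d v = num_dot l ((-1) ^+ l * d - v).
Proof.
elim: l v => [|l IHl] v Uv.
  rewrite num_dot0 expr0 mul1r subr_eq0 /num_row_transports.
  under eq_bigr => u _ do
    rewrite (sum_tuple0 _ (fun t => (row_act (u, v) t == (0, d)) : nat)) /=
            xpair_eqE.
  rewrite (bigD1 0) //= eqxx /= big1 ?addn0 1?eq_sym //.
  by move=> u /andP[_ /negPf->].
rewrite num_dotS; apply: eq_bigr => u Iu.
rewrite (sum_tupleS _ _ (fun t => (row_act (u, v) t == (0, d)) : nat)).
apply: eq_bigr => a Ia.
have Uw : u * a + v \is a GRing.unit by rewrite addrC IU // IM.
transitivity (num_row_transports l d (- (u * a + v))); last first.
  rewrite IHl ?unitrN // -[LHS]num_dotN exprS; congr num_dot; ring.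
rewrite (sum_tupleS _ _ (fun t => (row_act (u, v) (a :: t) == (0, d)) : nat)).
rewrite /num_row_transports /=.
rewrite [RHS](reindex (fun b => (u * a + v) * b - u)) /=; last first.
  exists (fun y => (u * a + v)^-1 * (y + u)) => y _.
    by rewrite subrK mulKr.
  by rewrite mulVKr ?addrK.
apply: eq_bigl => b; apply/idP/idP => Ib; first by rewrite ID ?IN ?IM.
rewrite -[b](mulKr Uw) IM // -[X in X \in I](subrK u); exact: ID.
Qed.

(** Modulo the ideal, a product of an even number of matrices eta(a) with a in
the ideal is plus or minus the identity, so it preserves the rows with zero
second coordinate. *)
Let row_act_I u v l (t : (l.*2).-tuple S) :
  all [in I] t -> v \in I -> (row_act (u, v) t).2 \in I.
Proof.
elim: l u v t => [|l IHl] u v t; first by rewrite tuple0.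
case/tupleP: t => a t; case/tupleP: t => b t /= /and3P[Ia Ib It] Iv.
apply: (IHl _ _ t) => //=; apply: IN; exact: ID (IM _ Ia) Iv.
Qed.

(** For a cycle a, b, t the bottom row of the product does not involve a, and is
the image of (b, -1) under t. Once it is (0, eps), the first entry a has to be
eps times the top right entry of the product over t: the other condition on the
top row follows from the determinant. So counting cycles amounts to counting
the pairs (b, t) with the right bottom row. *)
Lemma num_ideal_cycles l eps : eps * eps = 1 ->
  (\sum_(t : (l.+1.*2).-tuple S | all [in I] t) is_cycle eps t =
   num_dot l ((-1) ^+ l.+1 * eps - 1)%R)%N.
Proof.
move=> eps2; rewrite (sum_tupleS _ _ (fun t => is_cycle eps t : nat)).
under eq_bigr => a _ do
  rewrite (sum_tupleS _ _ (fun t => is_cycle eps (a :: t) : nat)).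
rewrite exchange_big /=.
transitivity (num_row_transports l eps (-1)); last first.
  rewrite num_row_transportsE ?unitrN1 // -num_dotN exprS.
  by congr num_dot; ring.
apply: eq_bigr => b Ib; rewrite exchange_big /=; apply: eq_bigr => t It.
have I2 : (row_act (1, 0) t).2 \in I by apply: row_act_I.
have detE := row_act_det (b, -1) (1, 0) t.
have qE a : is_cycle eps [:: a, b & t] =
    (a * (row_act (b, -1) t).1 - (row_act (1, 0) t).1 == eps)
 && (a * (row_act (b, -1) t).2 - (row_act (1, 0) t).2 == 0)
 && (row_act (b, -1) t == (0, eps)).
  rewrite /is_cycle /= /row_step /= !mul1r !mul0r !addr0 add0r subr0 mul1r.
  congr (_ && _).
  rewrite -xpair_eqE; congr (_ == _).
  rewrite [LHS]row_act_basis [row_act (b, _) _]row_act_basis /=.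
  congr (_, _); ring.
under eq_bigr => a _ do rewrite qE.
case: (row_act (b, -1) t =P (0, eps)) => [E|_]; last first.
  by rewrite big1 // => a _; rewrite andbF.
move: I2 detE; rewrite E; case: (row_act (1, 0) t) => g1 g2 /= I2 detE.
have g1E : g1 = - eps.
  rewrite -[LHS]mul1r -eps2; transitivity (- (eps * (0 * g2 - eps * g1))).
    by ring.
  by rewrite detE; ring.
rewrite (bigD1 (eps * g2)) ?IM //= big1 => [|a /andP[_ /eqP ne]].
  by rewrite addn0 g1E mulr0 add0r opprK mulrC mulrA eps2 mul1r subrr !eqxx.
rewrite mulr0 add0r g1E opprK eqxx subr_eq0; case: eqP => // e.
by case: ne; rewrite -e mulrC -mulrA eps2 mulr1.
Qed.

End IdealCycles.

(** * The ideals generated by the powers of p *)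
Section PrimePowerRing.

Variables p r : nat.
Hypotheses (p_pr : prime p) (r_gt0 : (0 < r)%N).
Local Notation R := 'Z_(p ^ r).
Implicit Types x y w : R.

Let p_gt0 : (0 < p)%N. Proof. exact: prime_gt0. Qed.

Lemma pr_gt1 : (1 < p ^ r)%N.
Proof. by rewrite -(exp1n r) ltn_exp2r // prime_gt1. Qed.
Hint Resolve pr_gt1 : core.

(** The ideal generated by p^k, provided k <= r: divisibility of representatives
is then compatible with reduction mod p^r. *)
Definition pideal k : pred R := [pred x : R | (p ^ k %| (x : nat))%N].

Lemma pideal_nat k m : (k <= r)%N -> ((m%:R : R) \in pideal k) = (p ^ k %| m)%N.
Proof.
by move=> le_kr; rewrite inE val_Zp_nat // /dvdn modn_dvdm // dvdn_exp2l.
Qed.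

Lemma pidealP k x : (k <= r)%N ->
  reflect (exists y, x = (p ^ k)%:R * y) (x \in pideal k).
Proof.
move=> le_kr; apply: (iffP idP) => [/dvdnP[q xE]|[y ->]].
  by exists q%:R; rewrite -natrM mulnC -xE natr_Zp.
by rewrite -[y]natr_Zp -natrM pideal_nat // dvdn_mulr.
Qed.

Lemma pideal_0 k : 0 \in pideal k. Proof. by rewrite inE dvdn0. Qed.

Lemma pidealD k : (k <= r)%N -> {in pideal k &, forall x y, x + y \in pideal k}.
Proof.
move=> le_kr x y /pidealP-/(_ le_kr)[x' ->] /pidealP-/(_ le_kr)[y' ->].
by rewrite -mulrDr; apply/pidealP => //; exists (x' + y').
Qed.

Lemma pidealM k y x : (k <= r)%N -> x \in pideal k -> y * x \in pideal k.
Proof.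
move=> le_kr /pidealP-/(_ le_kr)[x' ->]; apply/pidealP => //.
by exists (y * x'); ring.
Qed.

Lemma pidealB k : (k <= r)%N -> {in pideal k &, forall x y, x - y \in pideal k}.
Proof. by move=> le_kr x y ? ?; rewrite -mulN1r pidealD // pidealM. Qed.

Lemma pidealMM j k x y : (j + k <= r)%N -> x \in pideal j -> y \in pideal k ->
  x * y \in pideal (j + k).
Proof.
move=> le /pidealP-/(_ _)[|x' ->]; first by lia.
move=> /pidealP-/(_ _)[|y' ->]; first by lia.
by apply/pidealP => //; exists (x' * y'); rewrite expnD natrM; ring.
Qed.

Lemma pidealM1 k x y : (k < r)%N -> x \in pideal k -> y \in pideal 1 ->
  x * y \in pideal k.+1.
Proof. by rewrite -addn1; apply: pidealMM. Qed.

Lemma pideal_le j k x : (j <= k)%N -> x \in pideal k -> x \in pideal j.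
Proof.
by move=> le_jk; rewrite !inE; apply: dvdn_trans; rewrite dvdn_exp2l.
Qed.

Lemma pideal_r x : (x \in pideal r) = (x == 0).
Proof.
apply/idP/eqP => [/pidealP-/(_ (leqnn r))[y ->]|->]; last exact: pideal_0.
by rewrite (_ : (p ^ r)%:R = 0) ?mul0r // pchar_Zp.
Qed.

Lemma card_pideal k : (k <= r)%N -> #|pideal k| = (p ^ (r - k))%N.
Proof.
move=> le_kr; pose f (i : 'I_(p ^ (r - k))) : R := (p ^ k * i)%:R.
have fE i : (f i : nat) = (p ^ k * i)%N.
  rewrite val_Zp_nat // modn_small //.
  have <- : (p ^ k * p ^ (r - k) = p ^ r)%N by rewrite -expnD subnKC.
  by rewrite ltn_pmul2l ?expn_gt0 ?p_gt0.
have f_inj : injective f.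
  move=> i j /(congr1 (fun x : R => x : nat)); rewrite !fE => /eqP.
  by rewrite eqn_pmul2l ?expn_gt0 ?p_gt0 // => /eqP/val_inj.
rewrite -[RHS]card_ord -(card_codom f_inj); apply: eq_card => x.
apply/idP/codomP => [/dvdnP[q xE]|[i ->]]; last by rewrite inE fE dvdn_mulr.
have q_lt : (q < p ^ (r - k))%N.
  rewrite -(ltn_pmul2r (_ : 0 < p ^ k)%N) ?expn_gt0 ?p_gt0 //.
  rewrite -xE -expnD subnK //.
  by rewrite -[X in (_ < X)%N]Zp_cast //.
by exists (Ordinal q_lt); apply: val_inj; rewrite /= fE xE mulnC.
Qed.

Lemma unit_pideal x : (x \is a GRing.unit) = (x \notin pideal 1).
Proof.
by rewrite -[x in LHS]natr_Zp unitZpE // coprime_pexpl // prime_coprime // inE.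
Qed.

Lemma pideal_exact k y : (k < r)%N -> y \in pideal k -> y \notin pideal k.+1 ->
  exists2 u, u \is a GRing.unit & y = (p ^ k)%:R * u.
Proof.
move=> lt_kr /pidealP-/(_ (ltnW lt_kr))[u ->] nlev; exists u => //.
rewrite unit_pideal; apply: contra nlev => u1.
by rewrite pidealM1 // pideal_nat // ltnW.
Qed.

(** When the equation is solvable, translating by a solution in p R reduces it
to p^k z = 0, that is, to z in p^(r-k) R; as k < r, these z do lie in p R. *)
Lemma card_scale_ideal k w : (k < r)%N ->
  (\sum_(z in pideal 1) ((p ^ k)%:R * z == w)%R =
   (w \in pideal k.+1) * p ^ k)%N.
Proof.
move=> lt_kr; have pk : (p ^ k)%:R \in pideal k by rewrite pideal_nat // ltnW.
case: (boolP (w \in pideal k.+1)) => [|wN]; last first.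
  rewrite big1 // => z z1; case: eqP => // wE; case/negP: wN.
  by rewrite -wE pidealM1.
move=> /pidealP-/(_ lt_kr)[v wE].
have pv : p%:R * v \in pideal 1 by apply/pidealP => //; exists v; rewrite expn1.
rewrite mul1n (reindex_inj (addIr (p%:R * v))) /=.
rewrite -[in RHS](subKn (ltnW lt_kr)) -card_pideal ?leq_subr // -sum1_card.
rewrite -big_mkcondr /=; apply: eq_bigl => z.
rewrite mulrDr mulrA -natrM -expnSr -wE -[X in _ == X]add0r (inj_eq (addIr w)).
have -> : (z + p%:R * v \in pideal 1) = (z \in pideal 1).
  apply/idP/idP => zI; last exact: pidealD.
  by rewrite -[z](addrK (p%:R * v)) pidealB.
rewrite -pideal_r [in LHS]inE -[z in X in _ && X]natr_Zp -natrM pideal_nat //.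
rewrite -{2}(subnKC (ltnW lt_kr)) expnD dvdn_pmul2l ?expn_gt0 ?p_gt0 // inE.
rewrite andb_idl // => /(dvdn_trans _) -> //.
by rewrite dvdn_exp2l // subn_gt0.
Qed.

Lemma dot_pideal k (s t : seq R) : (k <= r)%N -> all [in pideal k] s ->
  dot s t \in pideal k.
Proof.
move=> le_kr; elim: s t => [|a s IHs] [|b t] /=;
  rewrite /dot ?big_nil ?pideal_0 // => /andP[ak sk].
by rewrite big_cons pidealD ?IHs // mulrC pidealM.
Qed.

Lemma dot_pideal1 k (s t : seq R) : (k < r)%N ->
  all [in pideal k] s -> all [in pideal 1] t -> dot s t \in pideal k.+1.
Proof.
move=> lt_kr; elim: s t => [|a s IHs] [|b t] /=;
  rewrite /dot ?big_nil ?pideal_0 // => /andP[ak sk] /andP[b1 t1].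
by rewrite big_cons pidealD ?IHs //= pidealM1.
Qed.

(** The map z |-> dot y z from (pR)^l is onto p^(k+1) R, and its fibers have the
same size p^((r-1)l - (r-k-1)); the power of p is moved to the left to avoid the
subtraction. A general value w is needed for the induction. *)
Lemma card_orthogonal l k (y : l.-tuple R) w : (k < r)%N ->
  all [in pideal k] y -> ~~ all [in pideal k.+1] y ->
  (p ^ (r - k.+1) * \sum_(z : l.-tuple R | all [in pideal 1] z) (dot y z == w) =
   (w \in pideal k.+1) * p ^ ((r - 1) * l))%N.
Proof.
move=> lt_kr; elim: l y w => [|l IHl] y w; first by rewrite tuple0.
case/tupleP: y => y0 y /= /andP[y0k yk].
rewrite (sum_tupleS _ _ (fun z => (dot (y0 :: y) z == w) : nat)).
have dotE z0 (z : seq R) :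
    (dot (y0 :: y) (z0 :: z) == w) = (dot y z == w - y0 * z0).
  by rewrite /dot /= big_cons /= addrC [in RHS]eq_sym subr_eq eq_sym.
have k1 z0 : z0 \in pideal 1 -> y0 * z0 \in pideal k.+1.
  by move=> z01; rewrite pidealM1.
(* Either the tail of y already has an entry of valuation exactly k, and z0
   only shifts w inside p^(k+1) R, or y0 is p^k times a unit, and each choice
   of the tail of z leaves an equation for z0. *)
case: (boolP (all [in pideal k.+1] y)) => [yk1|nyk1 _]; last first.
  rewrite big_distrr /=.
  rewrite (eq_bigr (fun=> (w \in pideal k.+1) * p ^ ((r - 1) * l)))%N =>
    [|z0 z01].
    by rewrite sum_nat_const card_pideal // mulnSr expnD; ring.
  under eq_bigr => z _ do rewrite dotE.
  rewrite IHl //; congr (nat_of_bool _ * _)%N; apply/idP/idP => wk.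
    by rewrite -[w](subrK (y0 * z0)) pidealD ?k1.
  by rewrite pidealB ?k1.
rewrite andbT => y0k1; have [u Uu y0E] := pideal_exact lt_kr y0k y0k1.
rewrite exchange_big /=.
rewrite (eq_bigr (fun=> (w \in pideal k.+1) * p ^ k))%N => [|z z1].
  rewrite sum_tuple_const.
  rewrite card_pideal // -expnM mulnSr expnD.
  have -> : (p ^ (r - 1) = p ^ (r - k.+1) * p ^ k)%N.
    by rewrite -expnD; congr expn; lia.
  by ring.
under eq_bigr => z0 _ do rewrite dotE.
have dk : dot y z \in pideal k.+1 by rewrite dot_pideal.
transitivity (\sum_(z0 in pideal 1)
    ((p ^ k)%:R * z0 == u^-1 * (w - dot y z))%R)%N.
  apply: eq_bigr => z0 _; congr nat_of_bool; rewrite y0E.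
  rewrite eq_sym subr_eq addrC -subr_eq eq_sym.
  by rewrite -[in RHS](inj_eq (mulrI Uu)) mulVKr // mulrCA mulrA.
rewrite card_scale_ideal //; congr (nat_of_bool _ * _)%N; apply/idP/idP => wk.
  rewrite -[w](subrK (dot y z)) pidealD // -[_ - _](mulVKr Uu) pidealM //.
by rewrite pidealM // pidealB.
Qed.

End PrimePowerRing.

(** * Orthogonal pairs and the value of sigma *)
Section CountOrthogonal.

Variables p r : nat.
Hypotheses (p_pr : prime p) (r_gt0 : (0 < r)%N).
Local Notation R := 'Z_(p ^ r).
Local Notation pideal := (@pideal p r).

Let p_neq0 : p%:R != 0 :> rat.
Proof. by rewrite pnatr_eq0 -lt0n prime_gt0. Qed.

(** The filtration of the first vector by the powers of p; at k = 1 this is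
the number of orthogonal pairs that is wanted. *)
Definition num_orth k l : nat :=
  (\sum_(y : l.-tuple R | all [in pideal k] y)
     \sum_(z : l.-tuple R | all [in pideal 1] z) (dot y z == 0%R))%N.

Lemma num_orth_r l : num_orth r l = (p ^ ((r - 1) * l))%N.
Proof.
rewrite /num_orth (eq_bigr (fun=> (p ^ ((r - 1) * l))%N)) => [|y yr].
  by rewrite sum_tuple_const card_pideal // subnn expn0 exp1n mul1n.
rewrite expnM -(card_pideal p_pr r_gt0) // -[RHS]muln1 -sum_tuple_const.
by apply: eq_bigr => z _; rewrite -(pideal_r p_pr r_gt0) dot_pideal.
Qed.

(** The vectors y in p^k but not in p^(k+1) number p^((r-k)l) - p^((r-k-1)l),
and each has as many orthogonal z as [card_orthogonal] says. *)
Lemma num_orthS k l : (k < r)%N ->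
  (num_orth k l)%:R = (num_orth k.+1 l)%:R
    + (p%:R ^+ ((r - k) * l) - p%:R ^+ ((r - k.+1) * l)) * p%:R ^+ ((r - 1) * l)
      / p%:R ^+ (r - k.+1) :> rat.
Proof.
move=> lt_kr; rewrite {1}/num_orth.
rewrite (bigID (fun y : l.-tuple R => all [in pideal k.+1] y)) /=.
have allE (y : l.-tuple R) :
    all [in pideal k] y && all [in pideal k.+1] y = all [in pideal k.+1] y.
  rewrite andb_idl // => /allP yk1; apply/allP => x /yk1.
  exact: pideal_le.
rewrite (eq_bigl _ _ allE) natrD; congr (_ + _).
set A := (X in X%:R = _); set B : rat := _ ^+ _ - _.
pose c := (\sum_(y : l.-tuple R |
  all [in pideal k] y && ~~ all [in pideal k.+1] y) 1)%N.
have cE : c%:R = B.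
  rewrite /B -!natrX !expnM -!(card_pideal p_pr r_gt0) //; last exact: ltnW.
  rewrite -[X in X%:R - _]muln1 -[X in _ - X%:R]muln1 -!sum_tuple_const.
  rewrite (bigID (fun y : l.-tuple R => all [in pideal k.+1] y)) /=.
  by rewrite (eq_bigl _ _ allE) natrD addrC addKr.
have AE : (p ^ (r - k.+1) * A = c * p ^ ((r - 1) * l))%N.
  rewrite /A /c big_distrr big_distrl /=; apply: eq_bigr => y /andP[yk yk1].
  by rewrite card_orthogonal // pideal_0.
apply/eqP; rewrite eq_sym -cE -!natrX -natrM -AE natrM mulrC mulKf //.
by rewrite pnatr_eq0 -lt0n expn_gt0 prime_gt0.
Qed.

(** Descending from k = r, the jth step of [num_orthS] adds the jth term of a
geometric series of ratio p^l / p. *)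
Lemma num_dot_geometric l :
  (num_dot (pideal 1) l 0)%:R = p%:R ^+ ((r - 1) * l)
    * (1 + (p%:R ^+ l - 1) * \sum_(i < r - 1) (p%:R ^+ l / p%:R) ^+ i) :> rat.
Proof.
suff H j : (j <= r)%N -> (num_orth (r - j) l)%:R = p%:R ^+ ((r - 1) * l)
    * (1 + (p%:R ^+ l - 1) * \sum_(i < j) (p%:R ^+ l / p%:R) ^+ i) :> rat.
  by rewrite -H ?leq_subr // subKn.
elim: j => [|j IHj] lt_jr.
  by rewrite subn0 num_orth_r natrX big_ord0 mulr0 addr0 mulr1.
rewrite num_orthS; last by lia.
rewrite (_ : (r - j.+1).+1 = (r - j)%N); last by lia.
rewrite (_ : (r - (r - j.+1) = j.+1)%N); last by lia.
rewrite (_ : (r - (r - j) = j)%N); last by lia.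
rewrite IHj 1?ltnW // big_ord_recr /= expr_div_n -!exprM [(l * j)%N]mulnC.
rewrite mulSn exprD.
field; exact: expf_neq0.
Qed.

(** The three cases of sigma: for l = 0 the factor p^l - 1 vanishes, for l = 1
the ratio is 1, and for l >= 2 the series is summed with ratio Q = p^(l-1). *)
Lemma num_dot_sigma l : (num_dot (pideal 1) l 0)%:R = sigma p r (l.+1.*2).
Proof.
rewrite num_dot_geometric /sigma doubleK subn1.
case: r r_gt0 => // s _; rewrite subn1 /=.
have sZ : s.+1%:Z - 1 = s%:Z by lia.
have expzB1 (a : rat) (n : nat) : a != 0 -> a ^ (n%:Z - 1) = a ^+ n / a.
  by move=> a0; rewrite expfzDr // exprN1 exprz_pmulz.
case: l => [|[|l]] /=.
- by rewrite muln0 expr0 subrr mul0r addr0 mulr1.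
- rewrite muln1 expr1 divff // (eq_bigr (fun=> 1)) => [|i _]; last first.
    exact: expr1n.
  rewrite sumr_const card_ord sZ -exprnP exprS -natr1; ring.
rewrite !sZ (_ : s.+1%:Z - 2 = s%:Z - 1); last by lia.
rewrite /qint (_ : (l.+3 - 2 = l.+1)%N); last by lia.
rewrite natrX; set P : rat := p%:R; set Q := P ^+ l.+1.
have Q0 : Q != 0 by apply: expf_neq0.
have Q1 : Q - 1 != 0.
  by rewrite subr_eq0 gt_eqF // exprn_egt1 // ltr1n prime_gt1.
have -> : P ^+ l.+2 = P * Q by rewrite -exprS.
have -> : P * Q / P = Q by rewrite mulrC mulKf.
have -> : \sum_(i < s) Q ^+ i = (Q ^+ s - 1) / (Q - 1).
  by rewrite subrX1 mulrC mulKf.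
rewrite !expzB1 // mulnC !exprM -exprnP (exprS P l.+1) -/Q exprSr.
by field; rewrite Q1 Q0 p_neq0.
Qed.

End CountOrthogonal.

(** * Lifting cycles from the residue field *)

(** There is no cycle of length one, and (0, 0) is the only one of length two. *)
Lemma is_cycle_size (S : comUnitRingType) (eps : S) (c : seq S) :
  is_cycle eps c -> has (fun x => x != 0) c -> (2 < size c)%N.
Proof.
case: c => [|a [|b [|//]]] //=; rewrite /is_cycle /= /row_step /= !xpair_eqE.
  by rewrite oppr_eq0 oner_eq0 andbF.
rewrite mul1r addr0 mul0r add0r oppr_eq0 subr0 mul1r => /andP[/andP[_ /eqP->]].
by case/andP=> /eqP -> _; rewrite eqxx.
Qed.

Lemma is_cycle_nseq0 (S : comUnitRingType) (eps : S) m :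
  is_cycle eps (nseq m.*2 0) = (eps == (-1) ^+ m).
Proof.
have runE u v :
    row_act (u, v) (nseq m.*2 0) = ((-1) ^+ m * u, (-1) ^+ m * v) :> S * S.
  elim: m u v => [|m IHm] u v; first by rewrite !mul1r.
  rewrite doubleS /= /row_step /= IHm exprSr; congr (_, _); ring.
by rewrite /is_cycle !runE !xpair_eqE !mulr0 !mulr1 eqxx andbT andbb eq_sym.
Qed.

Section Lifts.

Variables p r : nat.
Hypotheses (p_pr : prime p) (r_gt0 : (0 < r)%N).
Local Notation R := 'Z_(p ^ r).
Local Notation pideal := (@pideal p r).
Local Notation res := (@residue p r).

Lemma residue0 : res 0 = 0. Proof. exact: (residue_nat p_pr r_gt0 0). Qed.

Lemma residueN x : res (- x) = - res x.
Proof.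
by apply/eqP; rewrite -addr_eq0 -(residueD p_pr r_gt0) addNr residue0.
Qed.

Lemma residue_pideal x : (res x == 0) = (x \in pideal 1).
Proof. by rewrite /residue -(dvdn_pcharf (pchar_Fp p_pr)) inE expn1. Qed.

Lemma row_act_residue (c : seq R) u v :
  row_act (res u, res v) (map res c) =
  (res (row_act (u, v) c).1, res (row_act (u, v) c).2).
Proof.
elim: c u v => [|a c IHc] u v //=.
rewrite -IHc /row_step /= residueN (residueD p_pr r_gt0).
by rewrite (residueM p_pr r_gt0).
Qed.

Lemma is_cycle_residue eps (c : seq R) :
  is_cycle eps c -> is_cycle (res eps) (map res c).
Proof.
rewrite /is_cycle -(residue1 p_pr r_gt0) -residue0 !row_act_residue.
by case/andP=> /eqP-> /eqP->; rewrite /= !eqxx.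
Qed.

Lemma card_fiber1 a : (\sum_(x : R) (res x == a) = p ^ (r - 1))%N.
Proof.
have [y <-] := residue_surj p_pr r_gt0 a.
rewrite (reindex_inj (addIr y)) /= -(card_pideal p_pr r_gt0) // -sum1_card.
rewrite big_mkcond /=.
rewrite [RHS]big_mkcond; apply: eq_bigr => x _.
rewrite (residueD p_pr r_gt0) -[X in _ == X]add0r (inj_eq (addIr _)).
rewrite residue_pideal.
by case: (x \in pideal 1).
Qed.

Lemma card_fiber n (s : n.-tuple 'F_p) :
  (\sum_(t : n.-tuple R) (map res t == s) = p ^ ((r - 1) * n))%N.
Proof.
elim: n s => [|n IHn] s.
  rewrite (big_pred1 [tuple]) => [|t]; last by rewrite (tuple0 t) /= eqxx.
  by rewrite (tuple0 s) muln0.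
case/tupleP: s => a s /=.
rewrite (sum_tuple_cons n (fun t => (map res t == a :: s) : nat)).
under eq_bigr => x _ do under eq_bigr => t _ do rewrite /= eqseq_cons -mulnb.
under eq_bigr => x _ do rewrite -big_distrr IHn /=.
by rewrite -big_distrl /= card_fiber1 mulnS expnD.
Qed.

Variable eps : R.
Hypothesis eps2 : eps * eps = 1.

Let res2 : res eps * res eps = 1.
Proof. by rewrite -(residueM p_pr r_gt0) eps2 residue1. Qed.

Definition lifts n (s : seq 'F_p) : nat :=
  (\sum_(c : n.-tuple R) ((map res c == s) && is_cycle eps c))%N.

Lemma lifts_rot n k s : lifts n (rot k s) = lifts n s.
Proof.
rewrite /lifts.
rewrite (reindex (fun c : n.-tuple R => [tuple of rot k c])) /=; last first.
  exists (fun c : n.-tuple R => [tuple of rotr k c]) => c _; apply: val_inj.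
    exact: rotK.
  exact: rotrK.
apply: eq_bigr => c _; rewrite map_rot (inj_eq (@rot_inj k _)).
by rewrite [rot k c]/rot is_cycle_cat // cat_take_drop.
Qed.

(** Over a lift c of the tail t, [first_three] gives the only way to complete c
to a cycle: its denominator is a unit, as it reduces to b. That cycle
does reduce to x, b, y, t, by the same uniqueness in the residue field. *)
Lemma lifts_triple n x b y (t : n.-tuple 'F_p) : b != 0 ->
  is_cycle (res eps) [:: x, b, y & t] ->
  lifts n.+3 [:: x, b, y & t] = (p ^ ((r - 1) * n))%N.
Proof.
move=> b0 qs; rewrite -(card_fiber t) /lifts.
rewrite (sum_tuple_cons3 n
  (fun c => ((map res c == [:: x, b, y & t]) && is_cycle eps c) : nat)).
apply: eq_bigr => c _; case: (map res c =P t) => [tE|ne]; last first.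
  by rewrite big1 // => q _; rewrite /= !eqseq_cons (introF eqP ne) !andbF.
have run10 : (row_act (1, 0) t).1 = res (row_act (1, 0) c).1.
  by rewrite -tE -(residue1 p_pr r_gt0) -residue0 row_act_residue.
have bE := is_cycle_triple_mid qs.
have At : (row_act (1, 0) t).1 != 0.
  by apply: contra_neq b0; rewrite bE => ->; rewrite mulr0 oppr0.
have UA : (row_act (1, 0) c).1 \is a GRing.unit.
  by rewrite unit_pideal // -residue_pideal -run10.
rewrite (bigD1 (first_three eps c)) //= big1 => [|q nq].
  set q := first_three eps c.
  have qc : is_cycle eps [:: q.1.1, q.1.2, q.2 & c].
    by rewrite is_cycle_triple // -!surjective_pairing.
  have := is_cycle_residue qc.
  rewrite /= tE qc andbT addn0 !eqseq_cons eqxx andbT.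
  rewrite is_cycle_triple ?unitfE // => /eqP.
  move: qs; rewrite is_cycle_triple ?unitfE // => /eqP <- [-> -> ->].
  by rewrite !eqxx.
by rewrite is_cycle_triple // -!surjective_pairing (negPf nq) andbF.
Qed.

(** Reduce to [lifts_triple] by rotating a nonzero entry to the front, and then
one step further to the second position. *)
Lemma liftsE n (s : n.-tuple 'F_p) : has (fun x => x != 0) s ->
  is_cycle (res eps) s -> lifts n s = (p ^ ((r - 1) * (n - 3)))%N.
Proof.
move=> nz qs; have := is_cycle_size qs nz; rewrite size_tuple => n_gt2.
have qrot k (u : seq 'F_p) :
    is_cycle (res eps) (rot k u) = is_cycle (res eps) u.
  by rewrite /rot is_cycle_cat // cat_take_drop.
pose i := find (fun x => x != 0) s.
have i_lt : (i < size s)%N by rewrite -has_find.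
have si0 : nth 0 s i != 0 by apply: (nth_find 0 nz).
have rotE := drop_nth 0 i_lt.
have := size_rot i s; have := qrot i s; rewrite -(lifts_rot n i).
rewrite /rot rotE /=.
move: (s`_i) si0 (_ ++ _) => b b0 u; rewrite qs size_tuple.
case/lastP: u => [|u x]; first by move=> _ e; rewrite -e in n_gt2.
rewrite size_rcons -(qrot (size (rcons (b :: u) x) - 1)%N).
rewrite -(lifts_rot n (size (rcons (b :: u) x) - 1)).
rewrite -rcons_cons -/(rotr 1 _) rotr1_rcons.
case: u => [|y t] q n_size; rewrite -n_size // in n_gt2 *.
by rewrite (lifts_triple (t := in_tuple t)) // !subSS subn0.
Qed.

End Lifts.

(** * Counting *)

Lemma num_quiddityE (S : finComPzRingType) (eps : S) n :
  num_quiddity eps n = (\sum_(c : n.-tuple S) is_cycle eps c)%N.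
Proof.
rewrite /num_quiddity -sum1dep_card big_mkcond /=; apply: eq_bigr => c _.
by rewrite quiddityE; case: is_cycle.
Qed.

Definition num_nonzero_cycles (S : finComPzRingType) (eps : S) n : nat :=
  (\sum_(c : n.-tuple S | has (fun x => x != 0%R) c) is_cycle eps c)%N.

Lemma num_quiddity_field (S : finComUnitRingType) (eps : S) m :
  num_quiddity eps m.*2 =
  (num_nonzero_cycles eps m.*2 + (eps == (-1) ^+ m)%R)%N.
Proof.
rewrite num_quiddityE.
rewrite (bigID (fun c : _.-tuple S => has (fun x => x != 0) c)) /=.
congr (_ + _)%N; rewrite -is_cycle_nseq0.
rewrite (big_pred1 (nseq_tuple m.*2 0)) // => c.
rewrite -all_predC /= -val_eqE /=; apply/allP/eqP => [c0|-> x].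
  rewrite -[in RHS](size_tuple c); apply/all_pred1P/allP => x /c0 /=.
  by rewrite negbK.
by rewrite mem_nseq => /andP[_ /eqP->] /=; rewrite eqxx.
Qed.

Section Assembly.

Variables p r : nat.
Hypotheses (p_pr : prime p) (r_gt0 : (0 < r)%N).
Local Notation R := 'Z_(p ^ r).
Local Notation pideal := (@pideal p r).
Local Notation res := (@residue p r).
Variable eps : R.
Hypothesis eps2 : eps * eps = 1.

Lemma num_quiddity_split l :
  num_quiddity eps l.+1.*2 =
  (num_nonzero_cycles (res eps) l.+1.*2 * p ^ ((r - 1) * (l.+1.*2 - 3))
   + num_dot (pideal 1) l ((-1) ^+ l.+1 * eps - 1)%R)%N.
Proof.
set n := l.+1.*2; rewrite num_quiddityE.
rewrite (bigID (fun c : n.-tuple R => all [in pideal 1] c)) /= addnC.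
congr (_ + _)%N.
  rewrite /num_nonzero_cycles big_distrl /=.
  rewrite (eq_bigr (fun s : n.-tuple 'F_p => lifts eps n s)) => [|s nz];
    last first.
    case: (boolP (is_cycle (res eps) s)) => qs; first by rewrite mul1n liftsE.
    rewrite mul0n /lifts big1 // => c _; case: eqP => //= sE.
    case: (boolP (is_cycle eps c)) => // /(is_cycle_residue p_pr r_gt0).
    by rewrite sE (negPf qs).
  rewrite /lifts exchange_big /= big_mkcond /=; apply: eq_bigr => c _.
  have nzE : has (fun x => x != 0) (map res c) = ~~ all [in pideal 1] c.
    rewrite has_map -has_predC; apply: eq_has => x /=.
    by rewrite residue_pideal.
  rewrite -nzE; have [nz|z] := boolP (has _ _).
    rewrite (bigD1 [tuple of map res c]) //= eqxx big1 ?addn0 // => s /andP[_].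
    by rewrite -val_eqE /= eq_sym => /negPf->.
  rewrite big1 // => s nz; case: eqP => //= sE; by rewrite sE nz in z.
rewrite num_ideal_cycles //.
- exact: pideal_0.
- exact: pidealD.
- by move=> a x; apply: pidealM.
move=> u x; rewrite !unit_pideal // => u1 x1; apply: contra u1 => ux.
by rewrite -[u](addrK x) pidealB.
Qed.

(** A product of two elements of p R lies in p^2 R, which is [pideal 2] only for
r > 1; for r = 1 it is still in [pideal 1]. *)
Lemma num_dot_eq0 l w :
  (1 < r)%N && (w \notin pideal 2) || (w \notin pideal 1) ->
  num_dot (pideal 1) l w = 0%N.
Proof.
move=> wN; rewrite /num_dot big1 // => y y1; rewrite big1 // => z z1.
case: eqP => // dotE; case/orP: wN => [/andP[r_gt1]|]; last first.
  by rewrite -dotE dot_pideal.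
by rewrite -dotE dot_pideal1.
Qed.

(** For n = 2 the integer exponent differs from the truncated one, but there is
no nonzero cycle then. *)
Lemma nonzero_exponent l :
  (num_nonzero_cycles (res eps) l.+1.*2 * p ^ ((r - 1) * (l.+1.*2 - 3)))%:R =
  (num_nonzero_cycles (res eps) l.+1.*2)%:R
    * p%:R ^ ((r%:Z - 1) * (l.+1.*2%:Z - 3)) :> rat.
Proof.
case: l => [|l].
  rewrite /num_nonzero_cycles big1 ?mul0n ?mul0r // => c nz.
  case: (boolP (is_cycle _ c)) => // /is_cycle_size-/(_ nz).
  by rewrite size_tuple.
rewrite natrM natrX exprnP; congr (_ * _ ^ _).
by rewrite PoszM; congr (_ * _); lia.
Qed.

End Assembly.

Theorem theorem1p2 (p r n : nat) (eps : 'Z_(p ^ r)) :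
  prime p -> (0 < r)%N -> (1 < n)%N -> ~~ odd n -> eps = 1 \/ eps = -1 ->
  let omega : rat := (num_quiddity (residue eps) n)%:R in
  let N : rat := (num_quiddity eps n)%:R in
  let e : int := (r%:Z - 1) * (n%:Z - 3) in
  [/\ eps = (-1) ^+ n./2 -> N = (omega - 1) * p%:R ^ e + sigma p r n,
      eps <> (-1) ^+ n./2 -> (2 < p)%N -> N = omega * p%:R ^ e
    & eps <> (-1) ^+ n./2 -> p = 2%N -> N = (omega - 1) * p%:R ^ e].
Proof.
move=> p_pr r_gt0 n_gt1 n_even eps_pm.
have eps2 : eps * eps = 1 by case: eps_pm => ->; rewrite ?mulrNN mulr1.
have nE := even_halfK n_even; move: nE n_gt1; case: (n./2) => [|l] <- // _.
move=> omega N e.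
have signR2 : (-1) ^+ l.+1 * (-1) ^+ l.+1 = 1 :> 'Z_(p ^ r).
  by rewrite -exprD addnn -muln2 mulnC exprM sqrrN expr1n expr1n.
have NE : N = (num_nonzero_cycles (residue eps) l.+1.*2)%:R * p%:R ^ e
              + (num_dot (@pideal p r 1) l ((-1) ^+ l.+1 * eps - 1))%:R.
  by rewrite /N num_quiddity_split // natrD nonzero_exponent.
have omegaE : omega = (num_nonzero_cycles (residue eps) l.+1.*2)%:R
                      + (residue eps == (-1) ^+ l.+1)%:R.
  by rewrite /omega num_quiddity_field natrD.
have signF2 : (-1) ^+ l.+1 * (-1) ^+ l.+1 = 1 :> 'F_p.
  by rewrite -exprD addnn -muln2 mulnC exprM sqrrN expr1n expr1n.
have resX : residue ((-1) ^+ l.+1 : 'Z_(p ^ r)) = (-1) ^+ l.+1.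
  elim: l.+1 => [|k IHk]; first by rewrite residue1.
  by rewrite !exprS residueM // IHk residueN // residue1.
have neg : eps <> (-1) ^+ l.+1 -> eps = - (-1) ^+ l.+1.
  rewrite -signr_odd.
  by case: odd eps_pm => -[] ->; rewrite ?expr0 ?expr1 ?opprK.
split=> [epsE | /neg epsE p_gt2 | epsN pE].
- rewrite NE omegaE epsE resX eqxx addrK signR2 subrr.
  by rewrite num_dot_sigma.
- have two : (2%:R : 'Z_(p ^ r)) \notin @pideal p r 1.
    by rewrite pideal_nat // expn1 gtnNdvd.
  rewrite NE omegaE num_dot_eq0 //; last first.
    apply/orP; right; apply: contra two => w1.
    have -> : 2%:R = - 1 * ((-1) ^+ l.+1 * eps - 1) :> 'Z_(p ^ r).
      by rewrite epsE mulrN signR2; ring.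
    exact: pidealM.
  rewrite epsE residueN // resX; case: eqP => [e0|]; last by rewrite !addr0.
  have : 2%:R == 0 :> 'F_p.
    apply/eqP.
    transitivity ((-1) ^+ l.+1 * ((-1) ^+ l.+1 - - (-1) ^+ l.+1) : 'F_p).
      by rewrite opprK mulrDr signF2.
    by rewrite e0 subrr mulr0.
  by rewrite -(dvdn_pcharf (pchar_Fp p_pr)) gtnNdvd.
- have epsE := neg epsN.
  have r_gt1 : (1 < r)%N.
    rewrite ltn_neqAle r_gt0 andbT; apply/eqP => r1; case: epsN.
    have : (2%:R : 'Z_(p ^ r)) \in @pideal p r r.
      by rewrite pideal_nat // pE -r1.
    rewrite pideal_r // => /eqP two0; rewrite epsE.
    transitivity ((-1) ^+ l.+1 - 2%:R * (-1) ^+ l.+1 : 'Z_(p ^ r)).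
      by ring.
    by rewrite two0 mul0r subr0.
  have two : (2%:R : 'Z_(p ^ r)) \notin @pideal p r 2.
    by rewrite pideal_nat // pE.
  rewrite NE omegaE num_dot_eq0 //; last first.
    apply/orP; left; rewrite r_gt1; apply: contra two => w1.
    have -> : 2%:R = - 1 * ((-1) ^+ l.+1 * eps - 1) :> 'Z_(p ^ r).
      by rewrite epsE mulrN signR2; ring.
    exact: pidealM.
  have two0 : 2%:R = 0 :> 'F_p.
    by rewrite -[X in X%:R = _]pE (pcharf0 (pchar_Fp p_pr)).
  have -> : residue eps = (-1) ^+ l.+1.
    rewrite epsE residueN // resX.
    transitivity ((-1) ^+ l.+1 - 2%:R * (-1) ^+ l.+1 : 'F_p); first by ring.
    by rewrite two0 mul0r subr0.
  by rewrite eqxx addrK addr0.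
Qed.
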